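(* Let $A$ be a unital prime ring with $\mathrm{char}(A)\ne 2,3,5$ and let $S,T:A\to A$ be additive maps such that $S(x^2)=T(x)^2$ for every $x\in A$. If $T$ is bijective, then $T$ is a weighted Jordan homomorphism.
   Context: Rings are associative. In any ring, $x\circ y=xy+yx$ denotes the Jordan product. An additive map $\Phi:A\to B$ between unital rings is a Jordan homomorphism if $\Phi(x\circ y)=\Phi(x)\circ\Phi(y)$ for all $x,y\in A$. An additive map $T:A\to B$ is a weighted Jordan homomorphism if $c=T(1)$ is an invertible element lying in the center of $B$ and $x\mapsto c^{-1}T(x)$ is a Jordan homomorphism, that is, $cT(x\circ y)=T(x)\circ T(y)$ for all $x,y\in A$. *)

(* Defs.v *)
From HB Require Import structures.
From mathcomp Require Import all_boot all_algebra.

Set Implicit Arguments.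
Unset Strict Implicit.
Unset Printing Implicit Defensive.

Import GRing.Theory.
Local Open Scope ring_scope.

(* [nzRingType] bundles [1 != 0], so the zero ring is never prime. *)
Definition prime_ring (A : nzRingType) : Prop :=
  forall a b : A, (forall x : A, a * x * b = 0) -> a = 0 \/ b = 0.

Definition jordan_prod (A : nzRingType) (x y : A) : A := x * y + y * x.

(* A Jordan homomorphism is not required to map 1 to 1. *)
Definition jordan_hom (A B : nzRingType) (f : A -> B) : Prop :=
  zmod_morphism f /\
  forall x y : A, f (jordan_prod x y) = jordan_prod (f x) (f y).

Definition central (B : nzRingType) (c : B) : Prop :=
  forall b : B, GRing.comm c b.

(* The witness [d] is the inverse of [T 1], which is unique. It is quantified
   because a general ring does not carry the decidable unit predicate of
   [unitRingType]. *)
Definition weighted_jordan_hom (A B : nzRingType) (T : A -> B) : Prop :=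
  [/\ zmod_morphism T,
      central (T 1) &
      exists d : B,
        [/\ d * T 1 = 1, T 1 * d = 1 & jordan_hom (fun x : A => d * T x)]].

(* Main.v *)
Require Import Defs.
From HB Require Import structures.
From mathcomp Require Import all_boot all_algebra.
From Stdlib Require Ncring_tac.

Set Implicit Arguments.
Unset Strict Implicit.
Unset Printing Implicit Defensive.

Import GRing.Theory.
Local Open Scope ring_scope.

(** Write [x <o> y] for the Jordan product, [c = T 1], [T u = 1] and
[d = T (u ^+ 2)]. Polarizing the hypothesis gives
[S (x <o> y) = T x <o> T y]; hence [T x <o> T y] depends only on [x <o> y], and
every way to write one element as two different sums of Jordan products yields
an equation between values of [T]. Comparing with [1 <o> (x <o> y)] turns them
into [c <o> T (x <o> y) = (T x <o> T y) *+ 2] ([T_jordan]). Once [c] is central,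
this formula says that [T] is a weighted Jordan homomorphism, so the whole
difficulty is the centrality of [c] ([central_T1]).

The powers of [u] are mapped to [c, 1, d, d^2, d^3] and force [d] to be the
inverse of [c] ([T1_inverse]), so it is enough to show that [d] is central, that
is, that the inner derivation [D = ad d] vanishes.

The maps [a |-> a <o> u^k] are transported by [T] to explicit operators built
from left and right multiplication by [c] and [d]. For [k = 1] it is four times
the inverse of [y |-> c <o> y], and for [k = 2] it is
[y |-> d * y * d *+ 2] ([T_jordan_u2E]). In the source, the maps for [k = 1, 2, 3]
are power sums in two commuting operators, the left and right multiplications
by [u], hence satisfy a Newton identity ([T_jordan_uu]). Transported, it reads
[D^4 = 0] ([ad_pow4]), and in a prime ring without 2- and 5-torsion this
improves to [D^3 = 0] ([derivation_cube_eq0]).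

Polarizing [x^2 <o> x^2 = x <o> x^3] and taking its part quadratic in [a] and in
[u^2] gives an identity in [y = T a] and [d] alone ([quartic_identity]); using
[u^2] and not [u] is what makes all inverses of [y |-> c <o> y] disappear.
Rewritten in terms of [D] ([quartic_identity_ad]), it collapses, once [D^3 = 0],
to [D y * D (D y) = 0] up to a factor [4 * d]. Then [D (D x)] commutes with every
[D y], and primeness gives [D = 0] ([derivation_eq0]). *)

(** * Normalization in noncommutative rings *)

#[local] Instance ncring_ops (A : nzRingType) :
  @Ncring.Ring_ops A 0 1 +%R *%R (fun x y => x - y) -%R eq := {}.

#[local] Instance ncring_ring (A : nzRingType) :
  Ncring.Ring (Ro := ncring_ops A).
Proof.
split; rewrite /Algebra_syntax.equality /Ncring.eq_notation
  /Algebra_syntax.addition /Ncring.add_notation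
  /Algebra_syntax.multiplication /Ncring.mul_notation
  /Algebra_syntax.zero /Ncring.zero_notation
  /Algebra_syntax.one /Ncring.one_notation
  /Algebra_syntax.subtraction /Ncring.sub_notation
  /Algebra_syntax.opposite /Ncring.opp_notation;
  try by move=> *; rewrite ?(add0r, addrA, mulrA, mul1r, mulr1,
                             mulrDl, mulrDr, subrr).
- exact: RelationClasses.eq_equivalence.
- by move=> x _ <- y _ <-.
- by move=> x _ <- y _ <-.
- by move=> x _ <- y _ <-.
- by move=> x _ <-.
- exact: addrC.
Qed.

(* Numerals and powers are unfolded to sums and products first, because the
   reification treats any other term as an indeterminate. *)
Ltac ncring :=
  intros; rewrite /jordan_prod ?(exprS, expr0) ?mulrS ?mulr0n;
  Ncring_tac.non_commutative_ring.

Local Notation "x <o> y" := (jordan_prod x y) (at level 40).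

(** * Torsion in prime rings *)

Lemma prime_ring_torsion_free (A : nzRingType) (p : nat) :
  prime_ring A -> prime p -> p \notin [pchar A] ->
  forall x : A, x *+ p = 0 -> x = 0.
Proof.
move=> primeA p_pr charA x xp0.
have [|//|p0] := primeA x p%:R.
  by move=> y; rewrite mulr_natr -mulrnAl xp0 mul0r.
by rewrite inE p_pr p0 eqxx in charA.
Qed.

(** * Nilpotent derivations of prime rings *)

Section Derivations.

Variables (A : nzRingType) (D : {additive A -> A}).
Hypothesis primeA : prime_ring A.
Hypothesis DM : forall x y, D (x * y) = D x * y + x * D y.

(** Nilpotency indices of derivations of prime rings are odd in good
characteristic. The Leibniz expansion of [D^4 (x * y) = 0], taken at [(D x, y)]
and at [(x, D y)], is a linear system of determinant 20 for [D^3 x * D^2 y] and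
[D^2 x * D^3 y]; so [D^3 x] kills [D^2 y], and expanding [D^2 (w * y)] moves an
arbitrary [w] between two values of [D^3]. *)
Lemma derivation_cube_eq0 :
    (forall x : A, x *+ 2 = 0 -> x = 0) -> (forall x : A, x *+ 5 = 0 -> x = 0) ->
  (forall x, D (D (D (D x))) = 0) -> forall x, D (D (D x)) = 0.
Proof.
move=> tors2 tors5 D4.
have leib x y : (D (D (D x)) * D y) *+ 4 + (D (D x) * D (D y)) *+ 6
    + (D x * D (D (D y))) *+ 4 = 0.
  have := D4 (x * y); rewrite !(DM, raddfD) /= !D4 => <-; ncring.
have D32 x y : D (D (D x)) * D (D y) = 0.
  have e1 := leib (D x) y; have e2 := leib x (D y).
  rewrite !D4 in e1 e2.
  (* Three times the first equation minus twice the second isolates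
     10 (= 18 - 8) times the product. *)
  apply/tors5/tors2; rewrite -mulrnA.
  transitivity ((0 * D y *+ 4 + D (D (D x)) * D (D y) *+ 6
      + D (D x) * D (D (D y)) *+ 4) *+ 3
    - (D (D (D x)) * D (D y) *+ 4 + D (D x) * D (D (D y)) *+ 6 + D x * 0 *+ 4) *+ 2).
    ncring.
  by rewrite e1 e2 !mul0rn subrr.
have D3D x w y : D (D (D x)) * D w * D y *+ 2 + D (D (D x)) * w * D (D y) = 0.
  transitivity (D (D (D x)) * D (D (w * y)) - D (D (D x)) * D (D w) * y).
    rewrite !(DM, raddfD) /=; ncring.
  by rewrite !D32 mul0r subrr.
have D3DD x w y : D (D (D x)) * D w * D (D y) = 0.
  by have := D3D x (D w) y; rewrite D32 mul0r mul0rn add0r.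
move=> x; case: (primeA (a := D (D (D x))) (b := D (D (D x)))) => // w.
by have := D3D x w (D x); rewrite D3DD mul0rn add0r.
Qed.

Lemma derivation_cube_eq0_mul21 :
    (forall x : A, x *+ 3 = 0 -> x = 0) -> (forall x, D (D (D x)) = 0) ->
  forall x y, D (D x) * D y = - (D x * D (D y)).
Proof.
move=> tors3 D3 x y; apply/eqP; rewrite -addr_eq0; apply/eqP/tors3.
have := D3 (x * y); rewrite !(DM, raddfD) /= !D3 => <-; ncring.
Qed.

(** The combination is the right-hand side of [quartic_identity_ad]. Each term
contains [D] three times or more. After the Leibniz rule
[D (D x) * D (D x) = - D x * D (D (D x)) = 0], so only [D x * D (D x)] and
[D (D x) * D x] survive, and these are opposite: [3 - 14 + 7 = -4] copies of the
former remain. *)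
Lemma derivation_cube_eq0_quartic :
    (forall x : A, x *+ 3 = 0 -> x = 0) -> (forall x, D (D (D x)) = 0) ->
  forall d x,
  (D (x * D (D x)) *+ 3 + D (D (D (x * x))) *+ 3 - D (D (x * D x)) *+ 7
      - (x * D (D (D x))) *+ 2) * d
    - D (x * D (D (D x))) - D (D (x * D (D x))) - D (D (D (x * D x)))
  = - (D x * D (D x) * d *+ 4).
Proof.
move=> tors3 D3 d x; have D21 := derivation_cube_eq0_mul21 tors3 D3.
rewrite !D3 !(mulr0, raddf0) !(DM, raddfD) /= !D3 !raddf0 !D21 !D3; ncring.
Qed.

(** Polarizing [D x * D (D x) = 0] against [D (D x) * D y = - D x * D (D y)] shows
that [D (D x)] commutes with all [D y]. Applied to [D (y * z)], this puts an
arbitrary [z] between two values of [D (D _)], which kills [D (D _)]; then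
[D x * D y = 0], and [z] can be placed between [D x] and [D y]. *)
Lemma derivation_eq0 :
    (forall x : A, x *+ 2 = 0 -> x = 0) -> (forall x : A, x *+ 3 = 0 -> x = 0) ->
    (forall x, D (D (D x)) = 0) -> (forall x, D x * D (D x) = 0) ->
  forall x, D x = 0.
Proof.
move=> tors2 tors3 D3 D12.
have D21 := derivation_cube_eq0_mul21 tors3 D3.
have D21C x y : D (D x) * D y = D y * D (D x).
  rewrite D21; apply/eqP; rewrite eq_sym -addr_eq0; apply/eqP.
  have := D12 (x + y); rewrite !raddfD /= => e.
  transitivity ((D x + D y) * (D (D x) + D (D y)) - D x * D (D x) - D y * D (D y)).
    ncring.
  by rewrite e !D12 !subr0.
have D22 x y : D (D x) * D (D y) = 0.
  by rewrite D21 D3 mulr0 oppr0.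
have comm_sum x y z :
  D y * (D (D x) * z - z * D (D x)) + (D (D x) * y - y * D (D x)) * D z = 0.
  transitivity (D (D x) * D (y * z) - D (y * z) * D (D x)
    - (D (D x) * D y - D y * D (D x)) * z - y * (D (D x) * D z - D z * D (D x))).
    rewrite DM; ncring.
  by rewrite !D21C !subrr mul0r mulr0 !subrr.
have D2 x : D (D x) = 0.
  case: (primeA (a := D (D x)) (b := D (D x))) => // z.
  have := comm_sum x (D x) z.
  rewrite !D21C subrr mul0r addr0 mulrBr [X in X - _]mulrA D22 mul0r add0r.
  by rewrite mulrA => /eqP; rewrite oppr_eq0 => /eqP.
have D11 x y : D x * D y = 0.
  apply/tors2; have := D2 (x * y).
  rewrite !(DM, raddfD) /= !D2 => <-; ncring.
move=> x; case: (primeA (a := D x) (b := D x)) => // z.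
by have := D11 (x * z) x; rewrite DM mulrDl -[X in _ + X]mulrA D11 mulr0 addr0.
Qed.

End Derivations.

(** * Inner derivations *)

Definition ad (A : nzRingType) (d x : A) : A := d * x - x * d.

Lemma ad_is_zmod_morphism (A : nzRingType) (d : A) : zmod_morphism (ad d).
Proof. by move=> x y; rewrite /ad; ncring. Qed.

HB.instance Definition _ (A : nzRingType) (d : A) :=
  GRing.isZmodMorphism.Build A A (ad d) (ad_is_zmod_morphism d).

Lemma adM (A : nzRingType) (d x y : A) : ad d (x * y) = ad d x * y + x * ad d y.
Proof. by rewrite /ad; ncring. Qed.

(** Let [l], [m], [r] be the multiplications by [d] to the left of, between and
to the right of the two factors of [x * x]. They commute, and [D] acts on the
second factor as [m - r] and on the product as [l - r]. The left-hand side is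
[8 l m^2 r + 4 l r^3 + 4 l^3 r - 6 l^2 r^2 - 2 l m r^2 - 2 l^2 m r
- (m r^3 + m^2 r^2 + m^3 r + l m^3 + l^2 m^2 + l^3 m)], and the right-hand side
is its expansion in powers of [l - r] and [m - r]: nothing of degree below three
occurs. *)
Lemma quartic_identity_ad (A : nzRingType) (d x : A) :
  let D := ad d in
  (d * x * d * d * x * d) *+ 8 + (d * x * x * d ^+ 3) *+ 4
    + (d ^+ 3 * x * x * d) *+ 4 - (d ^+ 2 * x * x * d ^+ 2) *+ 6
    - (d * x * d * x * d ^+ 2) *+ 2 - (d ^+ 2 * x * d * x * d) *+ 2
    - x <o> (d * x * d ^+ 3 + d ^+ 2 * x * d ^+ 2 + d ^+ 3 * x * d)
  = (D (x * D (D x)) *+ 3 + D (D (D (x * x))) *+ 3 - D (D (x * D x)) *+ 7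
      - (x * D (D (D x))) *+ 2) * d
    - D (x * D (D (D x))) - D (D (x * D (D x))) - D (D (D (x * D x))).
Proof. by move=> D; rewrite /D /ad; ncring. Qed.

(** * Additive maps taking squares to squares *)

Section SquarePreservers.

Variables (A : nzRingType) (S T : {additive A -> A}).
Hypothesis tors2 : forall x : A, x *+ 2 = 0 -> x = 0.
Hypothesis ST : forall x : A, S (x ^+ 2) = T x ^+ 2.

Let mul2I (x y : A) : x *+ 2 = y *+ 2 -> x = y.
Proof. by move=> e; apply/subr0_eq/tors2; rewrite mulrnBl e subrr. Qed.

Lemma S_jordan x y : S (x <o> y) = T x <o> T y.
Proof.
transitivity (S ((x + y) ^+ 2) - S (x ^+ 2) - S (y ^+ 2)).
  by rewrite -!raddfB /=; congr (S _); ncring.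
rewrite !ST raddfD /=; ncring.
Qed.

Lemma T_jordan x y : T 1 <o> T (x <o> y) = (T x <o> T y) *+ 2.
Proof.
rewrite -!S_jordan -raddfMn /=; congr (S _); ncring.
Qed.

Variable u : A.
Hypothesis Tu : T u = 1.

Let c := T 1.
Let d := T (u ^+ 2).

(** Both sides come from Jordan products of powers of [u] with value
[2 * u^(i + j + 1)], the right one with [u] itself as a factor. *)
Lemma T_expr_jordan i j : T (u ^+ i) <o> T (u ^+ j.+1) = T (u ^+ (i + j)) *+ 2.
Proof.
transitivity (T u <o> T (u ^+ (i + j))); last by rewrite Tu; ncring.
rewrite -!S_jordan; congr (S _).
by rewrite /jordan_prod -!exprD -exprS -exprSr addnS [(j.+1 + i)%N]addnC addnS.
Qed.

Lemma T_exp3 : T (u ^+ 3) = d ^+ 2.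
Proof. by apply: mul2I; rewrite -(T_expr_jordan 2 1) -/d; ncring. Qed.

Lemma T_exp4 : T (u ^+ 4) = d ^+ 3.
Proof. by apply: mul2I; rewrite -(T_expr_jordan 2 2) T_exp3 -/d; ncring. Qed.

(** The equations [c <o> d = 2] and [c <o> d^2 = 2 d] suffice: multiplying the
first by [d] on either side and comparing with the second gives [d c d = d],
hence [d^2 c = d = c d^2], and then [c d = c (d^2 c) = (c d^2) c = d c]. *)
Lemma T1_inverse : c * d = 1 /\ d * c = 1.
Proof.
have e2 : c <o> d = 1 *+ 2.
  by have := T_expr_jordan 0 1; rewrite add0n expr0 expr1 Tu.
have e3 : c <o> (d ^+ 2) = d *+ 2.
  by have := T_expr_jordan 0 2; rewrite add0n expr0 T_exp3.
have dcd : d * c * d = d.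
  apply: mul2I; apply/subr0_eq.
  transitivity (d * (c <o> d - 1 *+ 2) + (c <o> d - 1 *+ 2) * d
                - (c <o> (d ^+ 2) - d *+ 2)); first ncring.
  by rewrite e2 e3 !subrr mulr0 mul0r addr0 subr0.
have ddc : d * d * c = d.
  transitivity (d * (c <o> d) - d * c * d); first ncring.
  by rewrite e2 dcd; ncring.
have cdd : c * d * d = d.
  transitivity ((c <o> d) * d - d * c * d); first ncring.
  by rewrite e2 dcd; ncring.
have cd_dc : c * d = d * c by rewrite -{1}ddc !mulrA cdd.
have dc1 : d * c = 1.
  apply: mul2I; rewrite -e2 /jordan_prod cd_dc; ncring.
by rewrite cd_dc.
Qed.

Let cd : c * d = 1 := proj1 T1_inverse.
Let dc : d * c = 1 := proj2 T1_inverse.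

Lemma T_jordan_u a : c <o> T (a <o> u) = T a *+ 4.
Proof. by rewrite T_jordan Tu; ncring. Qed.

Lemma T_jordan_u2 a : c <o> T (a <o> u ^+ 2) = c <o> (d * T a * d *+ 2).
Proof.
rewrite T_jordan -/d; apply/esym.
transitivity ((c * d * T a * d + d * T a * d * c) *+ 2); first ncring.
by rewrite cd -[_ * d * c]mulrA dc; ncring.
Qed.

(** With [p_k] the map [a |-> a <o> u^k], that is, the power sum of degree [k] in
the left and right multiplications by [u], Newton's identity is
[2 p_3 = 3 p_1 p_2 - p_1^3]. Applying [c <o> T _] removes one factor [p_1]
from each term on the right ([T_jordan_u]). *)
Lemma T_jordan_uu a :
  T ((a <o> u) <o> u) = T (a <o> u ^+ 2) *+ 3 - T a <o> d ^+ 2.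
Proof.
have e3 : c <o> T (a <o> u ^+ 3) = (T a <o> d ^+ 2) *+ 2.
  by rewrite T_jordan T_exp3.
have ring_id : (a <o> u ^+ 3) *+ 2
   = ((a <o> u ^+ 2) <o> u) *+ 3 - ((a <o> u) <o> u) <o> u by ncring.
apply: mul2I; apply: mul2I.
transitivity (c <o> T (((a <o> u) <o> u) <o> u)); first by rewrite T_jordan_u; ncring.
transitivity ((c <o> T ((a <o> u ^+ 2) <o> u)) *+ 3 - (c <o> T (a <o> u ^+ 3)) *+ 2).
  transitivity (c <o> T (((a <o> u ^+ 2) <o> u) *+ 3 - (a <o> u ^+ 3) *+ 2)).
    by congr (c <o> T _); rewrite ring_id; ncring.
  rewrite raddfB !raddfMn /=; ncring.
rewrite T_jordan_u e3; ncring.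
Qed.

Hypothesis T_surj : forall y, exists x, T x = y.

(** Such an element anticommutes with [c], so [c <o> _] kills both terms on the
right of [T_jordan_uu]. It follows that [T ((a <o> u) <o> u)], hence
[T (a <o> u)], hence [T a = y], are killed too, since [c <o> T (_ <o> u)] recovers
[T _] up to the factor 4. *)
Lemma jordan_T1_eq0 y : c <o> y = 0 -> y = 0.
Proof.
have [a <-] := T_surj y => cy0.
have e2 : c <o> T (a <o> u ^+ 2) = 0.
  rewrite T_jordan_u2.
  transitivity ((c * d * T a * d + d * T a * (d * c)) *+ 2); first ncring.
  rewrite cd dc.
  transitivity ((d * c * T a * d + d * T a * (c * d)) *+ 2).
    by rewrite dc cd; ncring.
  transitivity (d * (c <o> T a) * d *+ 2); first ncring.
  by rewrite cy0 mulr0 mul0r mul0rn.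
have ed : c <o> (T a <o> d ^+ 2) = 0.
  transitivity ((c <o> T a) * (d * d) + d * d * (c <o> T a)
    + c * d * d * T a - T a * (c * d) * d + T a * d * (d * c) - d * (d * c) * T a).
    ncring.
  by rewrite cy0 dc cd; ncring.
have T1_0 : T (a <o> u) = 0.
  apply/tors2/tors2; rewrite -mulrnA -T_jordan_u T_jordan_uu.
  transitivity ((c <o> T (a <o> u ^+ 2)) *+ 3 - c <o> (T a <o> d ^+ 2)); first ncring.
  by rewrite e2 ed mul0rn subrr.
apply/tors2/tors2; rewrite -mulrnA -T_jordan_u T1_0; ncring.
Qed.

Lemma jordan_T1_inj x y : c <o> x = c <o> y -> x = y.
Proof.
move=> e; apply/subr0_eq/jordan_T1_eq0.
transitivity (c <o> x - c <o> y); first ncring.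
by rewrite e subrr.
Qed.

Lemma T_jordan_u2E a : T (a <o> u ^+ 2) = d * T a * d *+ 2.
Proof. exact/jordan_T1_inj/T_jordan_u2. Qed.

(** For [w = T ((a <o> u) <o> u)], applying [c <o> _] twice gives [16 T a], while
[T_jordan_uu] gives [w = 6 d x d - (d^2 x + x d^2)]. In terms of the left and right
multiplications [l], [r] by [d] this reads
[(l + r)^2 (6 l r - l^2 - r^2) = 16 l^2 r^2], that is, [(l - r)^4 = 0]. *)
Lemma ad_pow4 x : ad d (ad d (ad d (ad d x))) = 0.
Proof.
have [a <-] := T_surj x.
set w := T ((a <o> u) <o> u).
have cw : c <o> (c <o> w) = T a *+ 16.
  rewrite T_jordan_u -[16%N]/(4 * 4)%N mulrnA -(T_jordan_u a); ncring.
have wE : w = d * T a * d *+ 6 - T a <o> d ^+ 2.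
  rewrite /w T_jordan_uu T_jordan_u2E; ncring.
have dw : d * d * w + d * w * d *+ 2 + w * d * d = d * d * T a * d * d *+ 16.
  transitivity (d * d * (c <o> (c <o> w)) * d * d); last by rewrite cw; ncring.
  transitivity (d * (d * c) * c * w * d * d + d * (d * c) * w * (c * d) * d *+ 2
     + d * d * w * c * (c * d) * d); last by ncring.
  by rewrite dc cd !mulr1 dc -[_ * c * d]mulrA cd; ncring.
apply/subr0_eq.
transitivity (d * d * T a * d * d *+ 16 - (d * d * w + d * w * d *+ 2 + w * d * d)).
  rewrite wE /ad; ncring.
by rewrite dw; ncring.
Qed.

(** With [U = u^2], the relation between Jordan products is
[(a <o> U) <o> (a <o> U) + 2 (a^2 <o> U^2)
= a <o> (a U^2 + U a U + U^2 a) + U <o> (a^2 U + a U a + U a^2)].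
The elements [T (a^2)] and [T (a <o> (a <o> U))] are known only through their
Jordan products with [c], but they occur only in Jordan products with [d] or
[d^3], and [d <o> f = d * (c <o> f) * d]. *)
Lemma quartic_identity x :
  (d * x * d * d * x * d) *+ 8 + (d * x * x * d ^+ 3) *+ 4
    + (d ^+ 3 * x * x * d) *+ 4 - (d ^+ 2 * x * x * d ^+ 2) *+ 6
    - (d * x * d * x * d ^+ 2) *+ 2 - (d ^+ 2 * x * d * x * d) *+ 2
  = x <o> (d * x * d ^+ 3 + d ^+ 2 * x * d ^+ 2 + d ^+ 3 * x * d).
Proof.
have [a <-] := T_surj x; set y := T a.
pose U := u ^+ 2; pose f := T (a * a).
have TU : T U = d by [].
have TUU : T (U * U) = d ^+ 3 by rewrite -exprD T_exp4.
have TaU b : T (b <o> U) = d * T b * d *+ 2 by exact: T_jordan_u2E.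
have cf : c <o> f = y * y *+ 2.
  apply: mul2I; transitivity (c <o> T (a <o> a)).
    rewrite /f /jordan_prod raddfD /=; ncring.
  rewrite T_jordan -/y; ncring.
have df : d <o> f = d * (y * y) * d *+ 2.
  transitivity (d * (c <o> f) * d); last by rewrite cf; ncring.
  transitivity (d * c * f * d + d * f * (c * d)); last by ncring.
  by rewrite cd dc; ncring.
have d3f : f <o> d ^+ 3
    = (d * (y * y) * d ^+ 3 - d ^+ 2 * (y * y) * d ^+ 2 + d ^+ 3 * (y * y) * d) *+ 2.
  transitivity ((d <o> f) * d ^+ 2 - d * (d <o> f) * d + d ^+ 2 * (d <o> f)).
    ncring.
  rewrite df; ncring.
have TaUU : T (a <o> (U * U))
    = (d * y * d ^+ 3 - d ^+ 2 * y * d ^+ 2 + d ^+ 3 * y * d) *+ 2.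
  apply: jordan_T1_inj; rewrite T_jordan TUU -/y.
  transitivity (((c * d) * y * d ^+ 3 - (c * d) * d * y * d ^+ 2
    + (c * d) * d ^+ 2 * y * d + d * y * d ^+ 2 * (d * c)
    - d ^+ 2 * y * d * (d * c) + d ^+ 3 * y * (d * c)) *+ 2); last by ncring.
  by rewrite cd dc; ncring.
have TaUaU : T (a * (U * U) + U * a * U + U * U * a)
    = d * y * d ^+ 3 + d ^+ 2 * y * d ^+ 2 + d ^+ 3 * y * d.
  apply: mul2I; rewrite -raddfMn /=.
  transitivity (T (a <o> (U * U)) + T ((a <o> U) <o> U)).
    by rewrite -raddfD /=; congr (T _); ncring.
  by rewrite TaUU !TaU -/y; ncring.
have TaaU : T (a * a * U + a * U * a + U * a * a) *+ 2
    = d * f * d *+ 2 + T (a <o> (a <o> U)).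
  transitivity (T ((a * a) <o> U) + T (a <o> (a <o> U))); last by rewrite TaU.
  by rewrite -raddfMn -raddfD /=; congr (T _); ncring.
have dTaaU : d <o> T (a <o> (a <o> U)) = d * (y <o> (d * y * d)) * d *+ 4.
  transitivity (d * (c <o> T (a <o> (a <o> U))) * d).
    transitivity (d * c * T (a <o> (a <o> U)) * d + d * T (a <o> (a <o> U)) * (c * d)).
      by rewrite cd dc; ncring.
    ncring.
  rewrite T_jordan TaU -/y; ncring.
have main : (T (a <o> U) <o> T (a <o> U)) + (f <o> d ^+ 3) *+ 2
    = (y <o> T (a * (U * U) + U * a * U + U * U * a))
      + d <o> T (a * a * U + a * U * a + U * a * a).
  rewrite -TUU -{1}TU -!S_jordan -raddfMn -!raddfD /=; congr (S _); ncring.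
have ddfd : d <o> (d * f * d) = d * (d <o> f) * d by ncring.
have : d <o> (T (a * a * U + a * U * a + U * a * a) *+ 2)
    = d * (d * (y * y) * d *+ 2) * d *+ 2 + d * (y <o> (d * y * d)) * d *+ 4.
  rewrite TaaU -dTaaU -df -ddfd; ncring.
move: (T (a * a * U + _ + _)) main => g; rewrite TaU d3f TaUaU -/y => main dg.
apply/mul2I/subr0_eq.
transitivity (((d * y * d *+ 2 <o> (d * y * d *+ 2)
      + (d * (y * y) * d ^+ 3 - d ^+ 2 * (y * y) * d ^+ 2
           + d ^+ 3 * (y * y) * d) *+ 2 *+ 2) *+ 2)
    - (d * (d * (y * y) * d *+ 2) * d *+ 2 + d * (y <o> (d * y * d)) * d *+ 4)
    - (y <o> (d * y * d ^+ 3 + d ^+ 2 * y * d ^+ 2 + d ^+ 3 * y * d)) *+ 2).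
  ncring.
by rewrite main -dg; ncring.
Qed.

End SquarePreservers.

Lemma central_T1 (A : nzRingType) (S T : {additive A -> A}) (u : A) :
    prime_ring A ->
    2%N \notin [pchar A] -> 3%N \notin [pchar A] -> 5%N \notin [pchar A] ->
    (forall x : A, S (x ^+ 2) = T x ^+ 2) ->
    T u = 1 -> (forall y, exists x, T x = y) ->
  central (T 1).
Proof.
move=> primeA ch2 ch3 ch5 ST Tu T_surj.
have tors2 := prime_ring_torsion_free primeA (isT : prime 2) ch2.
have tors3 := prime_ring_torsion_free primeA (isT : prime 3) ch3.
have tors5 := prime_ring_torsion_free primeA (isT : prime 5) ch5.
have [cd dc] := T1_inverse tors2 ST Tu.
have quartic := quartic_identity tors2 ST Tu T_surj.
have D4 := ad_pow4 tors2 ST Tu T_surj.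
set c := T 1 in cd dc *; set d := T (u ^+ 2) in cd dc quartic D4.
have D3 x : ad d (ad d (ad d x)) = 0.
  exact: (derivation_cube_eq0 primeA (adM d) tors2 tors5 D4).
have D12 x : ad d x * ad d (ad d x) = 0.
  have D12d : ad d x * ad d (ad d x) * d = 0.
    apply/tors2/tors2; rewrite -mulrnA; apply/eqP; rewrite -oppr_eq0; apply/eqP.
    rewrite -(derivation_cube_eq0_quartic (adM d) tors3 D3) /=.
    by rewrite -quartic_identity_ad quartic subrr.
  by rewrite -[LHS]mulr1 -dc mulrA D12d mul0r.
have D0 := derivation_eq0 primeA (adM d) tors2 tors3 D3 D12.
move=> x; rewrite /GRing.comm.
have dx : d * x = x * d by apply/subr0_eq/D0.
by rewrite -[c * x]mulr1 -dc mulrA -[c * x * d]mulrA -dx mulrA cd mul1r.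
Qed.

Theorem theorem3p8 (A : nzRingType) (S T : {additive A -> A})
    (primeA : prime_ring A)
    (charA2 : 2%N \notin [pchar A])
    (charA3 : 3%N \notin [pchar A])
    (charA5 : 5%N \notin [pchar A])
    (ST : forall x : A, S (x ^+ 2) = T x ^+ 2)
    (bijT : bijective T) :
  weighted_jordan_hom T.
Proof.
have T_surj y : exists x, T x = y by case: bijT => g _ gK; exists (g y).
have [u Tu] := T_surj 1.
have tors2 := prime_ring_torsion_free primeA (isT : prime 2) charA2.
have [cd dc] := T1_inverse tors2 ST Tu.
have cC := central_T1 primeA charA2 charA3 charA5 ST Tu T_surj.
split=> //; first exact: raddfB.
exists (T (u ^+ 2)); split=> //.
move: (T (u ^+ 2)) cd dc => d cd dc; split=> [x y | x y].
  by rewrite raddfB mulrBr.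
have dC z : d * z = z * d.
  by rewrite -[z * d]mul1r -dc -mulrA [T 1 * (z * d)]mulrA cC -mulrA cd mulr1.
have TE : T (x <o> y) = d * (T x <o> T y).
  apply/subr0_eq/tors2.
  transitivity (T (x <o> y) *+ 2 - d * (T 1 <o> T (x <o> y))).
    rewrite (T_jordan ST); ncring.
  rewrite /jordan_prod -cC; move: (T _) => z.
  transitivity ((1 - d * T 1) * z *+ 2); first ncring.
  by rewrite dc subrr mul0r mul0rn.
rewrite TE /jordan_prod.
transitivity (d * (d * T x) * T y + d * (d * T y) * T x); first ncring.
by rewrite !(dC (d * _)) !mulrA.
Qed.
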